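(* Let $G$ be a graph with cover ideal $J(G)$. (1) If $\chi(G)=\omega(G)$, then $\displaystyle\rho_a(J(G))=\rho(J(G))=2-\frac{2}{\omega(G)}$. In particular, this formula holds for any perfect graph. (2) If $G$ is a chordal graph, then $\displaystyle\rho_a(J(G))=\rho(J(G))=2-\frac{2}{\omega(G)}$. (3) If $\displaystyle\chi_f(G)=\frac{|V(G)|}{\alpha(G)}$, then $$2-\frac{2}{\chi_f(G)}\le\frac{\alpha(J(G))}{\hat\alpha(J(G))}\le\rho_a(J(G))\le\rho(J(G))\le2-\frac{2}{\chi(G)}.$$ Moreover, if in addition $\chi(G)=\chi_f(G)$, then $\displaystyle\frac{\alpha(J(G))}{\hat\alpha(J(G))}=\rho_a(J(G))=\rho(J(G))=2-\frac{2}{\chi(G)}$.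
   Context: All graphs are finite and simple, with no isolated vertices. $\chi(G)$, $\chi_f(G)$, $\omega(G)$ and $\alpha(G)$ denote respectively the chromatic number, the fractional chromatic number, the clique number and the independence number of $G$. A graph is perfect if $\chi(G[A])=\omega(G[A])$ for every induced subgraph $G[A]$, $A\subset V(G)$; it is chordal if it has no induced cycle of length greater than $3$. The cover ideal $J(G)$ of a graph $G$, over a field $\mathbb{K}$, is the ideal of $\mathbb{K}[x : x\in V(G)]$ generated by the monomials $\prod_{x\in\Gamma}x$, $\Gamma$ a vertex cover of $G$; equivalently $J(G)=\bigcap_{\{x,y\}\in E(G)}(x,y)$. For a homogeneous ideal $I$, $\alpha(I)$ is the minimal degree of a nonzero element of $I$ (so $\alpha(J(G))$ differs from the independence number $\alpha(G)$), and $\hat\alpha(I)=\lim_{s\to\infty}\alpha(I^{(s)})/s$ is the Waldschmidt constant. For an ideal $I$ in a Noetherian ring $R$, $I^{(s)}=\bigcap_{P\in\mathrm{Ass}(I)}(I^sR_P\cap R)$ is the $s$-th symbolic power. The resurgence and asymptotic resurgence are $\rho(I)=\sup\{s/t : s,t\in\mathbb{N},\ I^{(s)}\not\subset I^t\}$ and $\rho_a(I)=\sup\{s/t : s,t\in\mathbb{N},\ I^{(sr)}\not\subset I^{tr}\text{ for all } r\gg0\}$, where $\mathbb{N}$ denotes the positive integers. *)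

(* Defs.v *)
(* MathComp and MathComp-Analysis.  The notations of mpoly clash with those of
   MathComp-Analysis; mpoly comes first so that its names (such as symmetric)
   do not shadow those of MathComp. *)
From mathcomp Require Import -(notations) mpoly.
From HB Require Import structures.
From mathcomp Require Import all_boot all_order all_algebra.
From mathcomp Require Import all_classical all_reals all_analysis.

Set Implicit Arguments.
Unset Strict Implicit.
Unset Printing Implicit Defensive.

Import Order.TTheory GRing.Theory Num.Theory.
Import numFieldNormedType.Exports.

Local Open Scope classical_set_scope.
Local Open Scope ring_scope.

Section Ideals.
Variable A : idomainType.
Implicit Types (I P S : set A) (s t : nat).

Definition ideal_span S : set A :=
  [set f | exists (m : nat) (c g : 'I_m -> A),
     (forall i, S (g i)) /\ f = \sum_(i < m) c i * g i].

Definition is_ideal I :=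
  [/\ I 0, (forall f g, I f -> I g -> I (f + g)) &
      (forall c f, I f -> I (c * f))].

Definition prime_ideal P :=
  [/\ is_ideal P, ~ P 1 & forall f g, P (f * g) -> P f \/ P g].

Definition ideal_pow I t : set A :=
  ideal_span [set f | exists g : 'I_t -> A,
    (forall i, I (g i)) /\ f = \prod_(i < t) g i].

Definition colon I f : set A := [set g | I (g * f)].

Definition associated_primes I : set (set A) :=
  [set P | prime_ideal P /\ exists f, P = colon I f].

(* The ring A is a domain, so A_P is realized inside the field of fractions. *)
Definition localization P : set {fraction A} :=
  [set z | exists a u : A, ~ P u /\ z = tofrac a / tofrac u].

Definition localized_ideal I P : set {fraction A} :=
  [set z | exists (m : nat) (c : 'I_m -> {fraction A}) (g : 'I_m -> A),
     [/\ forall i, localization P (c i), forall i, I (g i) &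
         z = \sum_(i < m) c i * tofrac (g i)]].

Definition symbolic_pow I s : set A :=
  \bigcap_(P in associated_primes I)
    [set f | localized_ideal (ideal_pow I s) P (tofrac f)].

End Ideals.

Section Resurgence.
Variables (R : realType) (A : idomainType).
Implicit Type I : set A.

(* Suprema are taken in the extended reals, so that no boundedness is
   presupposed. *)
Definition resurgence I : \bar R :=
  ereal_sup [set q | exists s t : nat,
    [/\ (0 < s)%N, (0 < t)%N, ~ (symbolic_pow I s `<=` ideal_pow I t) &
        q = (s%:R / t%:R)%:E]].

Definition asymptotic_resurgence I : \bar R :=
  ereal_sup [set q | exists s t : nat,
    [/\ (0 < s)%N, (0 < t)%N,
        (\forall r \near \oo,
          ~ (symbolic_pow I (s * r) `<=` ideal_pow I (t * r))) &
        q = (s%:R / t%:R)%:E]].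

End Resurgence.

Section InitialDegree.
Variables (n : nat) (K : fieldType).
Local Notation A := (mpoly.mpoly n K).
Implicit Type I : set A.

(* mpoly.msize f is one more than the total degree of f when f is nonzero. *)
Definition has_elt_of_degree I (d : nat) : bool :=
  `[< exists f, [/\ I f, f != 0 & d = (mpoly.msize f).-1] >].

(* The value 0 is taken only when I has no nonzero element. *)
Definition initial_degree I : nat :=
  match pselect (exists d, has_elt_of_degree I d) with
  | left h => ex_minn h
  | right _ => 0%N
  end.

Definition waldschmidt (R : realType) I : R :=
  limn (fun s => (initial_degree (symbolic_pow I s))%:R / s%:R : R).

End InitialDegree.

Record sgraph := SGraph {
  vertex :> finType;
  edge : rel vertex;
  edge_sym : symmetric edge;
  edge_irrefl : irreflexive edge }.

Arguments edge {s}.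

Definition no_isolated (G : sgraph) := forall x : G, exists y : G, edge x y.

Definition induced (G : sgraph) (W : {set G}) : sgraph :=
  @SGraph {x : G | x \in W} (fun x y => edge (val x) (val y))
    (fun x y => edge_sym (val x) (val y)) (fun x => edge_irrefl (val x)).

Section GraphParameters.
Variable G : sgraph.

Definition clique (W : {set G}) :=
  [forall x in W, forall y in W, (x != y) ==> edge x y].

Definition independent (W : {set G}) :=
  [forall x in W, forall y in W, ~~ edge x y].

Definition vertex_cover (W : {set G}) :=
  [forall x, forall y, edge x y ==> (x \in W) || (y \in W)].

Definition clique_number : nat := \max_(W : {set G} | clique W) #|W|.

Definition independence_number : nat :=
  \max_(W : {set G} | independent W) #|W|.

Definition colorable (k : nat) :=
  [exists c : {ffun G -> 'I_k}, forall x, forall y, edge x y ==> (c x != c y)].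

Lemma colorable_card : exists k, colorable k.
Proof.
exists #|G|; apply/existsP; exists [ffun x => enum_rank x].
apply/forallP => x; apply/forallP => y; apply/implyP => exy.
rewrite !ffunE; apply: contraTneq exy => /enum_rank_inj ->.
by rewrite edge_irrefl.
Qed.

Definition chromatic_number : nat := ex_minn colorable_card.

(* The optimum of the linear program over nonnegative weights on the
   independent sets. *)
Definition fractional_chromatic_number (R : realType) : R :=
  inf [set q : R | exists w : {set G} -> R,
    [/\ forall W, 0 <= w W,
        forall x : G, 1 <= \sum_(W : {set G} | independent W && (x \in W)) w W &
        q = \sum_(W : {set G} | independent W) w W]].

Definition induced_cycle (c : seq G) :=
  ucycle edge c /\
  {in c &, forall x y, edge x y -> y = next c x \/ x = next c y}.

Definition chordal := forall c : seq G, induced_cycle c -> (size c <= 3)%N.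

Definition cover_ideal (K : fieldType) : set (mpoly.mpoly #|G| K) :=
  ideal_span [set f | exists2 W : {set G}, vertex_cover W &
    f = \prod_(x in W) mpoly.mpolyX K (mpoly.mnm1 (enum_rank x))].

End GraphParameters.

Arguments cover_ideal : clear implicits.

Definition perfect (G : sgraph) :=
  forall W : {set G},
    chromatic_number (induced W) = clique_number (induced W).

(* Main.v *)
Require Import Defs.
From mathcomp Require Import -(notations) mpoly.
From mathcomp Require Import all_boot all_order all_algebra.
From mathcomp Require Import all_classical all_reals all_analysis.
From mathcomp Require Import zify ring lra.

Set Implicit Arguments.
Unset Strict Implicit.
Unset Printing Implicit Defensive.

Import Order.TTheory GRing.Theory Num.Theory.
Import numFieldNormedType.Exports.
Local Open Scope ring_scope.

(** Write a monomial as its exponent function on the vertices, and call a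
function a an s-cover when a x + a y >= s on every edge x y.  The symbolic
power J^(s) is spanned by the monomials whose exponent is an s-cover
([symbolic_powE]), while J^t contains the monomials whose exponent dominates
a sum of t vertex covers.  Containments between powers, initial degrees and the
Waldschmidt constant thereby become questions about s-covers.

Upper bound.  If G has a proper colouring with k colours and
2 (k - 1) t <= s k, then every s-cover dominates a sum of t vertex covers
([packs_covers_colored]), so J^(s) is contained in J^t and the resurgence is at
most 2 - 2 / k.

Lower bound.  Let S be a set of vertices that every vertex cover meets in at
least c points, and let a be a 2-cover whose sum over S is b.  The exponent k a
is a 2k-cover of S-degree k b, whereas all monomials of J^t have S-degree at
least t c; hence J^(2k) is not contained in J^t when k b < t c, and the
asymptotic resurgence is at least 2 c / b ([asymptotic_resurgence_ge]).  With S
a maximum clique and a = 1 this gives 2 - 2 / omega, which meets the upper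
bound when chi = omega.  With S the set of all vertices and a a 2-cover of
least degree b it gives 2 alpha(J) / b.

The latter is the ratio alpha(J) / hat-alpha(J): a 2k-cover splits into k
2-covers ([edge_cover_split]), so that the Waldschmidt constant is b / 2.  The
constant function 1 shows b <= |V|, and the complement of a vertex cover is
independent, so alpha(J) >= |V| - alpha(G); together they bound the ratio below
by 2 - 2 alpha(G) / |V|.

Perfect graphs satisfy chi = omega by definition.  A chordal graph does because
each of its induced subgraphs has a vertex whose neighbours form a clique
([chordal_simplicial]), which allows greedy colouring with omega colours. *)

(** * Decomposing weighted covers into vertex covers *)

Section Packing.
Variable G : sgraph.
Implicit Types (a : G -> nat) (s t k : nat).
Local Open Scope nat_scope.

Definition edge_cover s a := forall x y : G, edge x y -> s <= a x + a y.

(** The existence of t vertex covers whose indicator functions sum to at most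
a; for the monomial with exponent a this is membership in J^t. *)
Definition packs_covers t a :=
  exists2 C : nat -> {set G}, forall j, j < t -> vertex_cover (C j) &
    forall x, \sum_(j < t) (x \in C j) <= a x.

Lemma vertex_coverP (W : {set G}) :
  reflect (forall x y, edge x y -> (x \in W) || (y \in W)) (vertex_cover W).
Proof.
apply: (iffP forallP) => [h x y exy|h x].
  by have /forallP/(_ y)/implyP := h x; apply.
by apply/forallP => y; apply/implyP => /h.
Qed.

Lemma packs_covers_add t1 t2 a1 a2 a :
  packs_covers t1 a1 -> packs_covers t2 a2 -> (forall x, a1 x + a2 x <= a x) ->
  packs_covers (t1 + t2) a.
Proof.
move=> [C1 C1P le1] [C2 C2P le2] le_a.
exists (fun j => if j < t1 then C1 j else C2 (j - t1)) => [j lt_j|x].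
  by case: ifP => [|ge_j]; [apply: C1P | apply: C2P; lia].
apply: leq_trans (le_a x); rewrite big_split_ord /=; apply: leq_add.
  by apply: leq_trans (le1 x); apply: leq_sum => i _; rewrite ltn_ord.
apply: leq_trans (le2 x); apply: leq_sum => i _.
by rewrite ltnNge leq_addr /= addKn.
Qed.

Lemma sum_ord_ltn v n : \sum_(i < n) (i < v) = minn v n.
Proof.
elim: n => [|n IHn]; first by rewrite big_ord0 minn0.
by rewrite big_ord_recr /= IHn; case: ltnP => ?; lia.
Qed.

(** The level sets a > j, for j < t, serve as covers: if both ends of an edge
lie outside one of them, then a is at most t - 1 at both ends and sums to at
most 2 t - 2 < s. *)
Lemma packs_covers_level s t a :
    2 * t <= s.+1 ->
    (forall x y, edge x y -> [|| t <= a x, t <= a y | s <= a x + a y]) ->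
  packs_covers t a.
Proof.
move=> le_ts aP; exists (fun j => [set x | j < a x]) => [j lt_jt|x].
  by apply/vertex_coverP => x y /aP; rewrite !inE; lia.
under eq_bigr do rewrite inE.
by rewrite sum_ord_ltn geq_minl.
Qed.

Section Peel.
Variables (k : nat) (c : G -> 'I_k.+2) (s t : nat) (a : G -> nat).
Hypothesis c_proper : forall x y, edge x y -> c x != c y.

(** One cover per colour i.  Vertices of colour i enter it at the threshold t;
those of another colour enter at the rank of i among the colours different from
their own.  A vertex thus meets the threshold t once and each of the thresholds
1, ..., k + 1 once, where k + 2 is the number of colours. *)
Definition peel_cover (i : nat) :=
  [set x | if i == c x then t <= a x else unbump (c x) i < a x].

Definition peel_load x := (t <= a x) + minn (a x) k.+1.

Lemma sum_peel x : \sum_(i < k.+2) (x \in peel_cover i) = peel_load x.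
Proof.
rewrite (bigD1_ord (c x)) //= inE eqxx /peel_load; congr (_ + _).
rewrite -sum_ord_ltn; apply: eq_bigr => i _.
by rewrite inE /= eq_sym (negPf (neq_bump _ _)) bumpK.
Qed.

Hypothesis aP :
  forall x y, edge x y -> [|| t <= a x, t <= a y | s <= a x + a y].
Hypothesis le_ts : 2 * k.+1 * t <= s * k.+2.
Hypothesis lt_st : s.+1 < 2 * t.

Lemma peel_arith : [/\ k.+2 <= t, 2 * k.+1 <= s & t + k <= s].
Proof. by split; nia. Qed.

(** The ends of an edge have different colours, so at most one of them faces
the threshold t.  If both were excluded, their sum would be at most t + k - 1,
or 2 k when neither has colour i, and both numbers are less than s. *)
Lemma peel_coverP i : i < k.+2 -> vertex_cover (peel_cover i).
Proof.
move=> lt_ik; have [le_kt le_ks le_tks] := peel_arith.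
apply/vertex_coverP => x y exy; have := aP exy; have := c_proper exy.
have := ltn_ord (c x); have := ltn_ord (c y).
rewrite !inE -val_eqE /= /unbump.
do 3!case: eqP => ?; lia.
Qed.

(** The disjunction with t <= a x is what makes the induction go through:
vertices at or above t lose one more unit than the others, which breaks the
sum condition at their edges but keeps them at or above the new t. *)
Lemma peel_rest x y : edge x y ->
  let a' z := a z - peel_load z in
  [|| t - k.+2 <= a' x, t - k.+2 <= a' y | s - 2 * k.+1 <= a' x + a' y].
Proof.
have [le_kt le_ks le_tks] := peel_arith.
by move=> /aP; rewrite /= /peel_load; lia.
Qed.

End Peel.

(** By induction on t.  Peeling off k + 2 covers, one per colour, replaces
(s, t) by (s - 2 (k + 1), t - (k + 2)), which preserves the difference
s (k + 2) - 2 (k + 1) t; once 2 t <= s + 1, level sets suffice. *)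
Lemma packs_covers_colored k (c : G -> 'I_k.+2) s t a :
    (forall x y, edge x y -> c x != c y) ->
    2 * k.+1 * t <= s * k.+2 ->
    (forall x y, edge x y -> [|| t <= a x, t <= a y | s <= a x + a y]) ->
  packs_covers t a.
Proof.
move=> c_proper; have [n] := ubnP t; elim: n s t a => // n IHn s t a lt_tn le_ts aP.
have [le_2t|lt_st] := leqP (2 * t) s.+1; first exact: packs_covers_level le_2t aP.
have [le_kt le_ks le_tks] := peel_arith le_ts lt_st.
rewrite -(subnKC le_kt).
apply: (@packs_covers_add _ _ (peel_load k t a) (fun z => a z - peel_load k t a z)).
- exists (peel_cover c t a) => [i lt_ik|x].
    exact: (peel_coverP c_proper aP le_ts lt_st lt_ik).
  by rewrite sum_peel.
- apply: (IHn (s - 2 * k.+1)); [lia | nia | exact: peel_rest].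
- by move=> x; rewrite subnKC // /peel_load; lia.
Qed.

(** The j-th summand counts which of the two thresholds j + 1 and 2 k - j are
reached.  They add up to 2 k + 1, so if one end of an edge misses the lower one
then the other end reaches both, and if both ends reach only the lower one
their sum is still 2. *)
Lemma edge_cover_split k a :
    edge_cover (2 * k) a ->
  exists2 b : nat -> G -> nat, forall j, j < k -> edge_cover 2 (b j) &
    forall x, \sum_(j < k) b j x <= a x.
Proof.
move=> aP; exists (fun j x => (j < a x) + (2 * k - j <= a x)).
  by move=> j lt_jk x y /aP; lia.
move=> x; rewrite big_split /= sum_ord_ltn.
have -> : \sum_(i < k) (2 * k - i <= a x) = minn (a x - k) k; last by lia.
(* read backwards, the upper thresholds are k + 1, ..., 2 k *)
rewrite (reindex_inj rev_ord_inj) /= -sum_ord_ltn; apply: eq_bigr => i _.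
by congr nat_of_bool; have := ltn_ord i; lia.
Qed.

End Packing.
(** * Ideals of an integral domain *)

Section IdealSpan.
Variable A : idomainType.
Implicit Types (I S : set A).

Lemma ideal_span_gen S f : S f -> ideal_span S f.
Proof.
by move=> Sf; exists 1%N, (fun=> 1), (fun=> f); split=> //; rewrite big_ord1 mul1r.
Qed.

Lemma ideal_span_min S I : is_ideal I -> (S `<=` I)%classic ->
  (ideal_span S `<=` I)%classic.
Proof.
move=> [I0 ID IM] SI f [m [c [g [Sg ->]]]].
by elim/big_ind: _ => // i _; apply/IM/SI/Sg.
Qed.

Lemma ideal_span_is_ideal S : is_ideal (ideal_span S).
Proof.
split.
- by exists 0%N, (fun=> 0), (fun=> 0); split=> [[]//|]; rewrite big_ord0.
- move=> _ _ [m [c [g [Sg ->]]]] [m' [c' [g' [Sg' ->]]]].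
  exists (m + m')%N, (fun i => match fintype.split i with inl j => c j | inr j => c' j end),
    (fun i => match fintype.split i with inl j => g j | inr j => g' j end).
  split=> [i|]; first by case: (fintype.split i).
  rewrite big_split_ord /=; congr (_ + _); apply: eq_bigr => i _.
    by case: split_ordP => j /eqP; rewrite ?eq_lshift ?eq_lrshift // => /eqP ->.
  by case: split_ordP => j /eqP; rewrite ?eq_rshift ?eq_rlshift // => /eqP ->.
- move=> d _ [m [c [g [Sg ->]]]]; exists m, (fun i => d * c i), g; split=> //.
  by rewrite mulr_sumr; apply: eq_bigr => i _; rewrite mulrA.
Qed.

End IdealSpan.

(** The lowest nonzero coefficient of a product is the product of the lowest
nonzero coefficients. *)
Lemma poly_mul_lowest (A : idomainType) (p q : {poly A}) s : q`_0 != 0 ->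
  (forall e, (e < s)%N -> (p * q)`_e = 0) -> forall e, (e < s)%N -> p`_e = 0.
Proof.
move=> q0 pq e; elim/ltn_ind: e => e IHe lt_es.
have := pq e lt_es; rewrite coefM big_ord_recr big1 /= => [|i _].
  by rewrite add0r subnn => /eqP; rewrite mulf_eq0 (negPf q0) orbF => /eqP.
by rewrite (IHe i (ltn_ord i) (ltn_trans (ltn_ord i) lt_es)) mul0r.
Qed.

(** * Ideals of polynomials cut out by a condition on monomials *)

Section MonomialIdeals.
Variables (n : nat) (K : fieldType).
Local Notation A := (mpoly n K).
Implicit Types (Q : multinom n -> Prop) (w : 'I_n -> nat) (f g u : A).

Definition monomials_in Q : set A := fun f => forall m, m \in msupp f -> Q m.

Lemma monomials_inX Q m : Q m -> monomials_in Q (mpolyX K m).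
Proof. by move=> Qm m'; rewrite msuppX inE => /eqP ->. Qed.

Lemma monomials_in_self m : monomials_in (eq m) (mpolyX K m).
Proof. exact: monomials_inX. Qed.

Lemma monomials_in_mul Q1 Q2 Q f g :
    (forall m1 m2, Q1 m1 -> Q2 m2 -> Q (mnm_add m1 m2)) ->
  monomials_in Q1 f -> monomials_in Q2 g -> monomials_in Q (f * g).
Proof.
move=> QM Q1f Q2g _ /msuppM_le /allpairsP[[m1 m2] /= [s1 s2 ->]].
by apply: QM; [apply: Q1f | apply: Q2g].
Qed.

Lemma monomials_in_ideal Q :
  (forall m1 m2, Q m2 -> Q (mnm_add m1 m2)) -> is_ideal (monomials_in Q).
Proof.
move=> QM; split.
- by move=> m; rewrite mcoeff_msupp mcoeff0 eqxx.
- move=> f g Qf Qg m /msuppD_le; rewrite mem_cat => /orP[]; [exact: Qf|exact: Qg].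
- by move=> c f; apply: (@monomials_in_mul xpredT) => // m1 m2 _; apply: QM.
Qed.

Lemma monomials_in_sub Q (I : set A) : is_ideal I ->
  (forall m, Q m -> I (mpolyX K m)) -> (monomials_in Q `<=` I)%classic.
Proof.
move=> [I0 ID IM] QI f Qf; rewrite [f]mpolyE big_seq.
elim/big_ind: _ => // m mf; rewrite -mul_mpolyC; exact/IM/QI/Qf.
Qed.

Definition weight w (m : multinom n) := (\sum_i w i * m i)%N.

Definition weight_ge w s := monomials_in (fun m => (s <= weight w m)%N).

Lemma weightD w m1 m2 : weight w (mnm_add m1 m2) = (weight w m1 + weight w m2)%N.
Proof.
by rewrite /weight -big_split; apply: eq_bigr => i _; rewrite mnmDE mulnDr.
Qed.

Lemma weight_ge_ideal w s : is_ideal (weight_ge w s).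
Proof.
by apply: monomials_in_ideal => m1 m2 h; rewrite weightD (leq_trans h) ?leq_addl.
Qed.

Lemma weight_ge_mul w s t f g :
  weight_ge w s f -> weight_ge w t g -> weight_ge w (s + t) (f * g).
Proof. by apply: monomials_in_mul => m1 m2 h1 h2; rewrite weightD leq_add. Qed.

Lemma weight_ge_pow w c (I : set A) t : (I `<=` weight_ge w c)%classic ->
  (ideal_pow I t `<=` weight_ge w (t * c))%classic.
Proof.
move=> Ic; apply: ideal_span_min; first exact: weight_ge_ideal.
move=> _ [g [Ig ->]]; elim: t g Ig => [|t IHt] g Ig.
  by rewrite big_ord0 mul0n => m _; apply: leq0n.
by rewrite big_ord_recl mulSn; apply: weight_ge_mul; [apply: Ic | apply: IHt].
Qed.

(** The substitution of X_i T^(w i) for X_i, where T is a new variable: the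
coefficient of T^e is the part of weight e.  It turns weight arguments into
statements about univariate polynomials over a domain. *)
Definition grading w : A -> {poly A} :=
  mmap (polyC \o @mpolyC n K) (fun i => (mpolyX K (mnm1 i))%:P * 'X^(w i)).

Lemma coef_grading w f e m :
  mcoeff m (grading w f)`_e = if weight w m == e then mcoeff m f else 0.
Proof.
have mono m' : mmap1 (fun i => (mpolyX K (mnm1 i))%:P * 'X^(w i)) m' =
    (mpolyX K m')%:P * 'X^(weight w m').
  rewrite /mmap1; under eq_bigr do rewrite exprMn -rmorphXn -exprM.
  rewrite big_split /= -rmorph_prod -mpolyXE_id; congr (_ * _).
  by rewrite /weight -expr_sum.
rewrite /grading /mmap coef_sum raddf_sum /=.
under eq_bigr => m' _.
  rewrite mono mulrA -polyCM coefCM coefXn mul_mpolyC.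
  over.
have [mf|mf] := boolP (m \in msupp f); last first.
  rewrite (memN_msupp_eq0 mf) if_same big_seq big1 // => m' m'f.
  rewrite mulr_natr mcoeffMn mcoeffZ mcoeffX.
  by have [E|_] := eqVneq m' m; [rewrite -E m'f in mf | rewrite mulr0 mul0rn].
rewrite (bigD1_seq m) ?msupp_uniq //= big1 => [|m' ne].
  rewrite addr0 mulr_natr mcoeffMn mcoeffZ mcoeffX eqxx mulr1 eq_sym.
  by case: eqP.
by rewrite mulr_natr mcoeffMn mcoeffZ mcoeffX (negPf ne) mulr0 mul0rn.
Qed.

Lemma weight_geP w s f :
  weight_ge w s f <-> (forall e, (e < s)%N -> (grading w f)`_e = 0).
Proof.
split=> [sf e lt_es|sf m mf].
  apply/mpolyP => m; rewrite mcoeff0 coef_grading; case: eqP => // we.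
  by apply: memN_msupp_eq0; apply/negP => /sf; rewrite we leqNgt lt_es.
rewrite leqNgt; apply/negP => /sf /(congr1 (mcoeff m)).
by rewrite coef_grading eqxx mcoeff0; apply/eqP; rewrite -mcoeff_msupp.
Qed.

Lemma gradingM w f g : grading w (f * g) = grading w f * grading w g.
Proof. exact: rmorphM. Qed.

(** An element with a part of weight 0 does not raise the least weight in a
product.  For w the indicator of the ends of an edge, this says that the powers
of the edge prime are primary. *)
Lemma weight_ge_cancel w s f u :
  ~ weight_ge w 1 u -> weight_ge w s (f * u) -> weight_ge w s f.
Proof.
move=> u0 /weight_geP; rewrite gradingM => fu.
apply/weight_geP; apply: poly_mul_lowest fu; apply/eqP => ue.
by case: u0; apply/weight_geP => -[].
Qed.

Lemma weight_ge_prime w : prime_ideal (weight_ge w 1).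
Proof.
split; first exact: weight_ge_ideal.
  move=> h.
  have : mnm0 \in msupp (1 : A) by rewrite msupp1 inE.
  by move=> /h; rewrite /weight big1 // => i _; rewrite mnm0E muln0.
move=> f g fg; case: (pselect (weight_ge w 1 g)) => [|ng]; first by right.
by left; apply: weight_ge_cancel ng fg.
Qed.

End MonomialIdeals.
(** * Symbolic powers of cover ideals *)

Section CoverIdeal.
Variables (G : sgraph) (K : fieldType).
Local Notation A := (mpoly #|G| K).
Local Notation J := (cover_ideal G K).
Implicit Types (a : G -> nat) (s t : nat) (m : multinom #|G|) (S W : {set G}).
Implicit Types (x y z : G) (f g u : A).

Definition exponent m : G -> nat := fun x => m (enum_rank x).

Definition monomial a : multinom #|G| :=
  Multinom [tuple a (enum_val i) | i < #|G|].

Lemma exponent_monomial a : exponent (monomial a) =1 a.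
Proof. by move=> x; rewrite /exponent mnmE enum_rankK. Qed.

Lemma exponentD m1 m2 x :
  exponent (mnm_add m1 m2) x = (exponent m1 x + exponent m2 x)%N.
Proof. exact: mnmDE. Qed.

Lemma exponentP m1 m2 : exponent m1 =1 exponent m2 -> m1 = m2.
Proof. by move=> E; apply/mnmP => i; rewrite -[i]enum_valK; apply: E. Qed.

Lemma monomials_div (I : set A) m a : is_ideal I ->
  I (mpolyX K (monomial a)) -> (forall x, (a x <= exponent m x)%N) ->
  I (mpolyX K m).
Proof.
move=> [_ _ IM] Ia am; rewrite -(@submK _ (monomial a) m) ?mpolyXD; first exact: IM.
by apply/mnm_lepP => i; rewrite mnmE -[X in m X]enum_valK; apply: am.
Qed.

Lemma cover_monomialE W :
  \prod_(x in W) mpolyX K (mnm1 (enum_rank x)) =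
  mpolyX K (monomial (fun x => x \in W)).
Proof.
rewrite mprodXE; congr mpolyX; apply: exponentP => y.
rewrite exponent_monomial /exponent mnm_sumE.
under eq_bigr do rewrite mnm1E (inj_eq enum_rank_inj).
have [Wy|nWy] := boolP (y \in W); last first.
  by rewrite big1 // => x Wx; case: eqP nWy => // <-; rewrite Wx.
by rewrite (bigD1 y) //= eqxx big1 // => x /andP[_ /negPf ->].
Qed.

Lemma cover_idealE f :
  J f <-> monomials_in (fun m => edge_cover 1 (exponent m)) f.
Proof.
split; move: f.
  apply: ideal_span_min.
    apply: monomials_in_ideal => m1 m2 c2 x y /c2.
    by rewrite !exponentD; lia.
  move=> _ [W /vertex_coverP Wc ->]; rewrite cover_monomialE.
  apply: monomials_inX => x y /Wc; rewrite !exponent_monomial.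
  by do 2!case: (_ \in _).
have Ji := ideal_span_is_ideal _ : is_ideal J.
apply: monomials_in_sub => // m mc.
pose W := [set x | (0 < exponent m x)%N].
apply: (@monomials_div _ _ (fun x => x \in W)) => // [|x]; last first.
  by rewrite inE; case: (exponent m x).
rewrite -cover_monomialE; apply: ideal_span_gen; exists W => //.
by apply/vertex_coverP => x y /mc; rewrite !inE; lia.
Qed.

Lemma cover_pow_monomial t m :
  packs_covers t (exponent m) -> ideal_pow J t (mpolyX K m).
Proof.
move=> [C Cc Cm].
apply: (@monomials_div _ _ (fun x => \sum_(j < t) (x \in C j))%N) => //.
  exact: ideal_span_is_ideal.
have -> : mpolyX K (monomial (fun x => \sum_(j < t) (x \in C j))%N) =
    \prod_(j < t) mpolyX K (monomial (fun x => x \in C j)).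
  rewrite mprodXE; congr mpolyX; apply: exponentP => x.
  rewrite exponent_monomial /exponent mnm_sumE; apply: eq_bigr => j _.
  by rewrite -/(exponent _ x) exponent_monomial.
apply: ideal_span_gen; exists (fun j : 'I_t => mpolyX K (monomial (fun x => x \in C j))).
split=> // j; rewrite -cover_monomialE; apply: ideal_span_gen.
by exists (C j) => //; apply: Cc.
Qed.

(** With S the two ends of an edge the weight measures membership in powers of
the edge prime; with S arbitrary it is the degree in the variables of S. *)
Definition set_weight S : 'I_#|G| -> nat := fun i => enum_val i \in S.

Lemma weight_set S m : weight (set_weight S) m = (\sum_(x in S) exponent m x)%N.
Proof.
rewrite /weight (reindex_onto enum_rank enum_val) => [|i _]; last exact: enum_valK.
rewrite big_mkcond [RHS]big_mkcond; apply: eq_bigr => x _ /=.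
by rewrite /set_weight enum_rankK eqxx; case: ifP; rewrite ?mul1n ?mul0n.
Qed.

Lemma edge_neq x y : edge x y -> x != y.
Proof. by apply: contraTneq => ->; rewrite edge_irrefl. Qed.

(** The prime (x, y). *)
Definition edge_prime x y : set A := weight_ge (set_weight [set x; y]) 1.

Lemma weight_edge x y m : edge x y ->
  weight (set_weight [set x; y]) m = (exponent m x + exponent m y)%N.
Proof.
by move=> /edge_neq xy; rewrite weight_set big_setU1 ?inE // big_set1.
Qed.

Lemma cover_ideal_edge x y : edge x y -> (J `<=` edge_prime x y)%classic.
Proof.
by move=> exy f /cover_idealE Jf m /Jf mc; rewrite weight_edge //; apply: mc.
Qed.

Lemma edge_prime_outside x y s : edge x y ->
  ~ edge_prime x y (mpolyX K (monomial (fun z => s * (z \notin [set x; y]))%N)).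
Proof.
move=> exy /(_ (monomial (fun z => s * (z \notin [set x; y]))%N)).
rewrite msuppX mem_seq1 eqxx => /(_ isT).
by rewrite weight_edge // !exponent_monomial !inE !eqxx !orbT !muln0.
Qed.

(** The edge prime is the annihilator, modulo J, of the product of the variables
outside the edge: that product hits all edges but x y. *)
Lemma edge_prime_associated x y : edge x y ->
  associated_primes J (edge_prime x y).
Proof.
move=> exy; split; first exact: weight_ge_prime.
exists (mpolyX K (monomial (fun z => 1 * (z \notin [set x; y]))%N)).
apply/seteqP; split=> f; last first.
  move=> /(cover_ideal_edge exy); apply: weight_ge_cancel.
  exact: edge_prime_outside.
move=> Pf; apply/cover_idealE.
apply: (monomials_in_mul _ Pf); last exact: monomials_in_self.
move=> m1 m2 /= w1 <- z1 z2 ez; rewrite !exponentD !exponent_monomial !mul1n.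
move: w1; rewrite weight_edge //.
case: (boolP (z1 \in _)) ez => [|_]; last by lia.
case: (boolP (z2 \in _)) => [|_]; last by lia.
by move=> /set2P[]-> /set2P[]->; rewrite ?edge_irrefl //; lia.
Qed.

(** Clearing denominators: they have a part of weight 0, so multiplying by them
does not change the least weight. *)
Lemma localized_weight_ge w s (I : set A) f : (I `<=` weight_ge w s)%classic ->
  localized_ideal I (weight_ge w 1) (tofrac f) -> weight_ge w s f.
Proof.
move=> Is [k [c [g [cP gI E]]]].
have [[P0 PD PM] P1 Pprime] := weight_ge_prime K w.
have [W0 WD WM] := weight_ge_ideal K w s.
suff [u [h [Pu Wh]]] : exists u h,
    [/\ ~ weight_ge w 1 u, weight_ge w s h & tofrac f * tofrac u = tofrac h].
  rewrite -tofracM => /eqP; rewrite tofrac_eq => /eqP fu.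
  by apply: weight_ge_cancel Pu _; rewrite fu.
rewrite E; elim/big_ind: _ => [|z1 z2 [u1 [h1 [Pu1 Wh1 E1]]] [u2 [h2 [Pu2 Wh2 E2]]]|i _].
- by exists 1, 0; rewrite mul0r tofrac0.
- exists (u1 * u2), (u2 * h1 + u1 * h2); split.
  + by move=> /Pprime[].
  + by apply: WD; apply: WM.
  + by rewrite tofracD !tofracM -E1 -E2; ring.
have [b [u [Pu ->]]] := cP i; exists u, (b * g i); split=> //.
  exact/WM/Is/gI.
have u0 : tofrac u != 0 by rewrite tofrac_eq0; apply/eqP => u0; apply: Pu; rewrite u0.
by rewrite tofracM mulrAC divfK.
Qed.

Lemma symbolic_pow_monomials s f : symbolic_pow J s f ->
  monomials_in (fun m => edge_cover s (exponent m)) f.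
Proof.
move=> Jf m mf x y exy; rewrite -weight_edge //; move: m mf.
apply: (@localized_weight_ge _ s (ideal_pow J s)); last first.
  exact: (Jf _ (edge_prime_associated exy)).
rewrite -[X in weight_ge _ X]muln1; apply: weight_ge_pow.
exact: cover_ideal_edge.
Qed.

(** If P = J : g then g is not in J, so some monomial of g misses an edge; the
corresponding edge prime contains J but not g, hence contains J : g. *)
Lemma associated_prime_sub_edge P : associated_primes J P ->
  exists x y, edge x y /\ (P `<=` edge_prime x y)%classic.
Proof.
move=> [[_ P1 _] [g EP]].
have Jg : ~ J g by move=> Jg; apply: P1; rewrite EP /colon /= mul1r.
have [x [y [exy gxy]]] : exists x y, edge x y /\ ~ edge_prime x y g.
  apply: contra_notP Jg => Ng; apply/cover_idealE => m mg x y exy.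
  rewrite -weight_edge //; apply: contra_notT Ng => lt1.
  by exists x, y; split=> // /(_ m mg); apply/negP.
exists x, y; split=> // h; rewrite EP => /(cover_ideal_edge exy).
exact: weight_ge_cancel.
Qed.

(** The covers used are the complements of x and of y, in the proportion
prescribed by a; all other variables are available s times. *)
Lemma packs_covers_edge x y s a : edge x y -> (s <= a x + a y)%N ->
  packs_covers s (fun z => a z + s * (z \notin [set x; y]))%N.
Proof.
move=> exy sa; have nxy := edge_neq exy.
exists (fun j => if (j < a x)%N then ~: [set y] else ~: [set x]) => [j _|z].
  apply/vertex_coverP => z1 z2 /edge_neq; case: ifP => _; rewrite !inE;
  by apply: contra_neqT; rewrite negb_or !negbK => /andP[/eqP -> /eqP ->].
have [->|zx] := eqVneq z x.
  rewrite (leq_trans _ (leq_addr _ _)) //.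
  under eq_bigr => j _.
    have -> : (x \in (if (j < a x)%N then ~: [set y] else ~: [set x])) = (j < a x)%N.
      by case: ifP; rewrite !inE ?nxy ?eqxx.
    over.
  by rewrite sum_ord_ltn geq_minl.
have [->|zy] := eqVneq z y.
  rewrite (leq_trans _ (leq_addr _ _)) // -(leq_add2l (minn (a x) s)).
  rewrite -{1}sum_ord_ltn -big_split /=.
  under eq_bigr => j _.
    have -> : ((j < a x)%N + (y \in (if (j < a x)%N then ~: [set y] else ~: [set x])) = 1)%N.
      by case: ifP; rewrite !inE ?[y == x]eq_sym ?nxy ?eqxx.
    over.
  by rewrite sum1_card card_ord; lia.
rewrite !inE negb_or zx zy muln1 (leq_trans _ (leq_addl _ _)) //.
rewrite -[X in (_ <= X)%N](card_ord s) -sum1_card; apply: leq_sum => j _.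
by case: (_ \in _).
Qed.

(** Every associated prime P lies in an edge prime (x, y), so the s-th power u
of the product of the variables other than x and y is invertible in the
localization at P, and the edge x y alone decides whether f u is in J^s. *)
Lemma monomials_symbolic_pow s f :
  monomials_in (fun m => edge_cover s (exponent m)) f -> symbolic_pow J s f.
Proof.
move=> fs P /associated_prime_sub_edge[x [y [exy Psub]]].
pose u := mpolyX K (monomial (fun z => s * (z \notin [set x; y]))%N).
have Pu : ~ edge_prime x y u := edge_prime_outside exy.
have u0 : tofrac u != 0.
  rewrite tofrac_eq0; apply/eqP => u0; apply: Pu; rewrite u0.
  by case: (weight_ge_ideal K (set_weight [set x; y]) 1).
exists 1%N, (fun=> tofrac 1 / tofrac u), (fun=> f * u); split.
- by move=> _; exists 1, u; split=> // /Psub.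
- move=> _; apply: (@monomials_in_sub _ _ (fun m => packs_covers s (exponent m))).
  + exact: ideal_span_is_ideal.
  + exact: cover_pow_monomial.
  apply: (monomials_in_mul _ fs); last exact: monomials_in_self.
  move=> m1 m2 /= c1 <-.
  have := packs_covers_edge exy (c1 _ _ exy).
  by move=> [C Cc Cm]; exists C => // z; rewrite exponentD exponent_monomial.
by rewrite big_ord1 tofrac1 mul1r tofracM mulrC mulfK.
Qed.

Lemma symbolic_powE s : symbolic_pow J s =
  monomials_in (fun m => edge_cover s (exponent m)).
Proof.
apply/seteqP; split=> f; [exact: symbolic_pow_monomials|exact: monomials_symbolic_pow].
Qed.

End CoverIdeal.
(** * Initial degrees and the Waldschmidt constant *)

Section InitialDegree.
Variables (n : nat) (K : fieldType).
Implicit Types (Q : multinom n -> Prop).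

Lemma initial_degreeP Q : (exists m, Q m) ->
  let d := initial_degree (monomials_in Q : set (mpoly n K)) in
  (exists2 m, Q m & mdeg m = d) /\ (forall m, Q m -> (d <= mdeg m)%N).
Proof.
move=> [m0 Qm0]; have degX m : Q m ->
    has_elt_of_degree (monomials_in Q : set (mpoly n K)) (mdeg m).
  move=> Qm; apply/asboolP; exists (mpolyX K m); split.
  - exact: monomials_inX.
  - by apply/eqP => /(congr1 (mcoeff m)) /eqP; rewrite mcoeffX eqxx mcoeff0 oner_eq0.
  - by rewrite msizeX.
rewrite /initial_degree /=; case: pselect => [h|[]]; last by exists (mdeg m0); apply: degX.
case: ex_minnP => d /asboolP[f [Qf f0 ->]] dmin; split=> [|m /degX /dmin //].
by exists (mlead f); [apply/Qf/mlead_supp | rewrite -mlead_deg].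
Qed.

End InitialDegree.

Section GraphDegrees.
Variables (G : sgraph) (K : fieldType).
Local Notation J := (cover_ideal G K).
Implicit Types (a : G -> nat) (s t : nat).

Definition cover_degree s := initial_degree (symbolic_pow J s).

Lemma mdeg_monomial a : mdeg (monomial a) = (\sum_x a x)%N.
Proof.
rewrite mdegE (reindex_onto enum_rank enum_val) => [|i _]; last exact: enum_valK.
by apply: eq_big => x; rewrite ?enum_rankK ?eqxx // -/(exponent _ x) exponent_monomial.
Qed.

Lemma cover_degreeP s :
  (exists2 a : G -> nat, edge_cover s a & (\sum_x a x)%N = cover_degree s) /\
  (forall a : G -> nat, edge_cover s a -> (cover_degree s <= \sum_x a x)%N).
Proof.
rewrite /cover_degree symbolic_powE.
have [|[m mc md] min] := @initial_degreeP _ K (fun m => edge_cover s (exponent (m : multinom #|G|))).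
  by exists (monomial (fun=> s)) => x y _; rewrite !exponent_monomial leq_addr.
split=> [|a ac]; last first.
  by rewrite -mdeg_monomial min // => x y; rewrite !exponent_monomial; apply: ac.
exists (exponent m) => //; rewrite -md -mdeg_monomial; congr mdeg.
by apply: exponentP => x; rewrite exponent_monomial.
Qed.

Lemma cover_ideal_symbolic1 : J = symbolic_pow J 1.
Proof. by apply/seteqP; split=> f; rewrite symbolic_powE; move/cover_idealE. Qed.

(** The lower bound splits a cover of even order into 2-covers, the upper bound
repeats a 2-cover of least degree. *)
Lemma cover_degree_bounds s :
  (s./2 * cover_degree 2 <= cover_degree s <= s./2.+1 * cover_degree 2)%N.
Proof.
have [[a ac ad] _] := cover_degreeP s; have [[a2 a2c a2d] min2] := cover_degreeP 2.
have [_ mins] := cover_degreeP s; apply/andP; split.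
  have [|b bc ba] := @edge_cover_split G s./2 a; first by move=> x y /ac; lia.
  rewrite -ad; apply: (@leq_trans (\sum_x \sum_(j < s./2) b j x)%N); last first.
    exact: leq_sum.
  rewrite exchange_big /= -[X in (X * _)%N]card_ord -sum_nat_const.
  by apply: leq_sum => j _; apply/min2/bc.
rewrite -a2d big_distrr /=; apply: mins => x y /a2c; nia.
Qed.

Lemma waldschmidt_half (R : realType) :
  waldschmidt R J = (cover_degree 2)%:R / 2 :> R.
Proof.
rewrite /waldschmidt; apply: cvg_lim => //; apply/cvgrPdist_le => e e0.
set b := cover_degree 2.
near=> s.
have s0 : 0 < (s%:R : R) by rewrite ltr0n; near: s; exact: nbhs_infty_gt.
have se : b%:R / e <= (s%:R : R) by near: s; exact: nbhs_infty_ger.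
have [lo hi] := andP (cover_degree_bounds s).
move: lo hi; rewrite -/(cover_degree s) -/b; set d := cover_degree s.
move=> lo hi.
have lo' : ((s.-1 * b)%:R <= (2 * d)%:R :> R) by rewrite ler_nat; nia.
have hi' : ((2 * d)%:R <= (s.+2 * b)%:R :> R) by rewrite ler_nat; nia.
have -> : b%:R / 2 - d%:R / s%:R = ((s * b)%:R - (2 * d)%:R) / (2 * s)%:R :> R.
  by rewrite !natrM; field; rewrite gt_eqF.
rewrite normrM normfV (ger0_norm (ler0n _ _)) ler_pdivrMr; last first.
  by rewrite natrM mulr_gt0.
apply: (@le_trans _ _ ((2 * b)%:R)); last first.
  move: se; rewrite ler_pdivrMr // => se; rewrite !natrM; nra.
rewrite ler_norml; apply/andP; split.
  rewrite lerBrDr addrC lerBlDr; apply: (le_trans hi').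
  by rewrite -natrD ler_nat; nia.
rewrite lerBlDr -lerBlDl; apply: le_trans lo'.
by rewrite lerBlDl -natrD ler_nat; nia.
Unshelve. all: end_near.
Qed.

End GraphDegrees.

(** * Bounds on the resurgence *)

Section Resurgence.
Variable R : realType.

(** A noncontainment for the pair (s r, t r) with one r >= 1 has ratio s / t. *)
Lemma asymptotic_resurgence_le (A : idomainType) (I : set A) :
  (asymptotic_resurgence R I <= resurgence R I)%E.
Proof.
apply: ub_ereal_sup => _ [s [t [s0 t0 [N _ NP] ->]]].
apply: ereal_sup_ubound; exists (s * N.+1)%N, (t * N.+1)%N; split.
- by rewrite muln_gt0 s0.
- by rewrite muln_gt0 t0.
- exact/NP/leqnSn.
by rewrite !natrM -mulf_div divff ?mulr1 // pnatr_eq0.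
Qed.

Variables (G : sgraph) (K : fieldType).
Local Notation J := (cover_ideal G K).

Lemma symbolic_pow_sub_colored k s t : colorable G k.+2 ->
  (2 * k.+1 * t <= s * k.+2)%N -> (symbolic_pow J s `<=` ideal_pow J t)%classic.
Proof.
move=> /existsP[c /forallP cP] le_ts; rewrite symbolic_powE.
apply: monomials_in_sub => [|m mc]; first exact: ideal_span_is_ideal.
apply/cover_pow_monomial/(packs_covers_colored (c := c) (s := s)) => // [x y|x y /mc ->].
  by have /forallP/(_ y)/implyP := cP x; apply.
by rewrite !orbT.
Qed.

Lemma resurgence_le_colored k : colorable G k.+2 ->
  (resurgence R J <= (2 - 2 / k.+2%:R)%:E)%E.
Proof.
move=> ck; apply: ub_ereal_sup => _ [s [t [s0 t0 nsub ->]]].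
have lt_st : (s * k.+2 < 2 * k.+1 * t)%N.
  by rewrite ltnNge; apply/negP => /(symbolic_pow_sub_colored ck).
have k0 : 0 < k.+2%:R :> R by rewrite ltr0n.
rewrite lee_fin ler_pdivrMr ?ltr0n // -(ler_pM2r k0).
have -> : (2 - 2 / k.+2%:R) * t%:R * k.+2%:R = (2 * k.+1 * t)%:R :> R.
  by rewrite !natrM -!natr1; field; rewrite gt_eqF //; have := ler0n R k; lra.
by rewrite -natrM ler_nat ltnW.
Qed.

(** Degrees in the variables of S separate the two powers: J^t lives in
S-degree at least t c, and k a is the exponent of a monomial of J^(2 k) of
S-degree less than t c. *)
Lemma not_symbolic_pow_sub (S : {set G}) c k t (a : G -> nat) :
    (forall W : {set G}, vertex_cover W -> (c <= #|S :&: W|)%N) ->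
    edge_cover 2 a -> (k * \sum_(x in S) a x < t * c)%N ->
  ~ (symbolic_pow J (2 * k) `<=` ideal_pow J t)%classic.
Proof.
move=> Sc ac lt_kt sub.
have JS : (J `<=` weight_ge (set_weight S) c)%classic.
  move=> f /cover_idealE Jf m /Jf mc; rewrite weight_set.
  pose W := [set x | (0 < exponent m x)%N].
  have /Sc cW : vertex_cover W.
    by apply/vertex_coverP => x y /mc; rewrite !inE; lia.
  apply: (leq_trans cW); rewrite -sum1_card [leqRHS](big_setID W) /=.
  by apply: leq_trans (leq_addr _ _); apply: leq_sum => x; rewrite !inE => /andP[].
have : symbolic_pow J (2 * k) (mpolyX K (monomial (fun x => k * a x)%N)).
  rewrite symbolic_powE; apply: monomials_inX => x y /ac.
  by rewrite !exponent_monomial; nia.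
move=> /sub /(weight_ge_pow JS) /(_ (monomial (fun x => k * a x)%N)).
rewrite msuppX mem_seq1 eqxx => /(_ isT); rewrite weight_set.
under eq_bigr do rewrite exponent_monomial.
by rewrite -big_distrr /= leqNgt lt_kt.
Qed.

(** The noncontainment for (2 k, t) persists for all multiples (2 k r, t r), and
2 k / t comes as close to 2 c / b as desired under the constraint k b < t c. *)
Lemma asymptotic_resurgence_ge (S : {set G}) c b (a : G -> nat) :
    (forall W : {set G}, vertex_cover W -> (c <= #|S :&: W|)%N) ->
    edge_cover 2 a -> (\sum_(x in S) a x)%N = b -> (0 < c)%N -> (0 < b)%N ->
  ((2 * c%:R / b%:R)%:E <= asymptotic_resurgence R J)%E.
Proof.
move=> Sc ac Sb c0 b0; apply/lee_addgt0Pr => e e0.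
have bR : 0 < b%:R :> R by rewrite ltr0n.
(* t = b N and k = c N - 1 satisfy k b < t c, and 2 k / t falls short of 2 c / b
   by 2 / (b N); adding 2 to the integer part makes k positive. *)
pose N := (Num.truncn (2 / e)).+2.
have N0 : 0 < N%:R :> R by rewrite ltr0n.
have Ne : 2 / e <= N%:R.
  by rewrite (le_trans (ltW (truncnS_gt _))) // ler_nat.
have k0 : (0 < c * N - 1)%N by rewrite /N; nia.
pose q : R := (2 * (c * N - 1))%:R / (b * N)%:R.
have ub : (q%:E <= asymptotic_resurgence R J)%E.
  apply: ereal_sup_ubound; exists (2 * (c * N - 1))%N, (b * N)%N; split=> //.
  - by rewrite muln_gt0 k0.
  - by rewrite muln_gt0 b0.
  exists 1%N => // r /= r0; rewrite -mulnA; apply: not_symbolic_pow_sub Sc ac _.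
  by rewrite Sb; nia.
apply: (@le_trans _ _ (q%:E + e%:E)%E); last by rewrite leeD2r.
rewrite -EFinD /q.
rewrite lee_fin !natrM natrB; last by nia.
rewrite natrM.
have -> : 2 * c%:R / b%:R =
    2 * (c%:R * N%:R - 1) / (b%:R * N%:R) + 2 / N%:R / b%:R :> R.
  by field; rewrite !gt_eqF.
rewrite lerD2l ler_pdivrMr // ler_pdivrMr //.
move: Ne; rewrite ler_pdivrMr // => Ne; apply: (le_trans Ne).
by rewrite mulrC -mulrA ler_pM2l // ler_peMl ?ler1n // ltW.
Qed.

End Resurgence.
(** * Cliques and colourings *)

Section Cliques.
Variable G : sgraph.
Implicit Types (x y z u v : G) (W S C : {set G}) (p q : seq G).

Lemma cliqueP W :
  reflect {in W &, forall x y, x != y -> edge x y} (clique W).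
Proof.
apply: (iffP forall_inP) => [h x y Wx Wy|h x Wx].
  by have /forall_inP/(_ y Wy)/implyP := h x Wx.
by apply/forall_inP => y Wy; apply/implyP; apply: h.
Qed.

Lemma clique_sub W1 W2 : W1 \subset W2 -> clique W2 -> clique W1.
Proof.
move=> /fintype.subsetP sub /cliqueP c; apply/cliqueP => x y /sub W1x /sub W1y.
exact: c.
Qed.

Lemma clique_number_ge W : clique W -> (#|W| <= clique_number G)%N.
Proof. by move=> cW; apply: (@leq_bigmax_cond _ _ (fun W : {set G} => #|W|)). Qed.

Lemma colorableP k : reflect
  (exists c : G -> 'I_k, forall x y, edge x y -> c x != c y) (colorable G k).
Proof.
apply: (iffP existsP) => -[c cP].
  by exists c => x y; have /forallP/(_ y)/implyP := forallP cP x.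
exists (finfun c); apply/forallP => x; apply/forallP => y; apply/implyP.
by rewrite !ffunE; apply: cP.
Qed.

Lemma colorable_chromatic : colorable G (chromatic_number G).
Proof. by rewrite /chromatic_number; case: ex_minnP. Qed.

Lemma chromatic_number_le k : colorable G k -> (chromatic_number G <= k)%N.
Proof. by rewrite /chromatic_number; case: ex_minnP => m _; apply. Qed.

Lemma clique_number_le_chromatic : (clique_number G <= chromatic_number G)%N.
Proof.
have /colorableP[c cP] := colorable_chromatic.
apply/bigmax_leqP => W /cliqueP Wc.
rewrite -[leqRHS]card_ord -(card_in_imset (f := c)) ?max_card // => x y Wx Wy.
by apply: contra_eq => /(Wc _ _ Wx Wy) /cP.
Qed.

(** * Induced cycles from shortest paths *)

Fixpoint induced_path x p :=
  if p is y :: p' then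
    [&& edge x y, all (fun z => ~~ edge x z && (x != z)) p' & induced_path y p']
  else true.

Lemma induced_path_uniq x p : induced_path x p -> uniq (x :: p).
Proof.
elim: p x => // y p IHp x /and3P[exy xp yp].
rewrite cons_uniq (IHp _ yp) andbT inE negb_or (edge_neq exy); apply/negP => /(allP xp).
by rewrite eqxx andbF.
Qed.

Lemma induced_path_path x p : induced_path x p -> path edge x p.
Proof. by elim: p x => //= y p IHp x /and3P[-> _ /IHp]. Qed.

Lemma induced_path_edge x p a b : induced_path x p ->
    a \in x :: p -> b \in x :: p -> edge a b ->
  exists p1 p2, x :: p = p1 ++ a :: b :: p2 \/ x :: p = p1 ++ b :: a :: p2.
Proof.
elim: p x => [|y p IHp] x /=.
  by rewrite !inE => _ /eqP-> /eqP->; rewrite edge_irrefl.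
move=> /and3P[exy /allP xp yp].
have near c : c \in y :: p -> edge x c -> c = y.
  by rewrite inE => /orP[/eqP //|/xp /andP[/negPf ->]].
rewrite [a \in _]inE [b \in _]inE.
move=> /orP[/eqP->|pa] /orP[/eqP->|pb]; first by rewrite edge_irrefl.
- by move=> /(near _ pb) ->; exists [::], p; left.
- by rewrite edge_sym => /(near _ pa) ->; exists [::], p; right.
move=> /(IHp _ yp pa pb)[p1 [p2 E]]; exists (x :: p1), p2.
by case: E => ->; [left|right].
Qed.

(** A path from x to y whose interior vertices q lie in C. *)
Definition detour C x y q := path edge x (rcons q y) && all (mem C) q.

(** A chord, or a repeated vertex, would give a shorter path. *)
Lemma shortest_detour_induced C x y q : y \notin C -> x != y ->
    detour C x y q ->
    (forall q', detour C x y q' -> (size q <= size q')%N) ->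
  induced_path x (rcons q y).
Proof.
move=> nCy; elim: q x => [|z q IHq] x nxy; rewrite /detour /=.
  by rewrite andbT => ->.
move=> /andP[/andP[exz zq] /andP[Cz Cq]] min; rewrite exz /=.
have tail w q1 q2 : q = q1 ++ w :: q2 ->
    path edge w (rcons q2 y) && all (mem C) (w :: q2).
  move=> Eq; move: zq Cq; rewrite Eq rcons_cat cat_path all_cat /=.
  by move=> /and3P[_ _ ->] /andP[_ ->].
apply/andP; split; last first.
  apply: IHq; [by apply: contraNneq nCy => <- | by rewrite /detour zq | ].
  move=> q' /andP[zq' Cq'].
  by apply: (min (z :: q')); rewrite /detour /= exz zq' (Cz : z \in C).
apply/allP => w; rewrite mem_rcons inE => /orP[/eqP->|qw].
  rewrite nxy andbT; apply/negP => exy.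
  by have := min [::]; rewrite /detour /= exy => /(_ isT).
case/splitPr Eq: _ / qw => [q1 q2]; have /andP[wq2 Cw] := tail _ _ _ Eq.
have sz : (size q2 < size q)%N by rewrite Eq size_cat /=; lia.
apply/andP; split; apply/negP.
  move=> exw; have := min (w :: q2).
  by rewrite /detour Cw /= exw wq2 ltnS leqNgt sz => /(_ isT).
move=> /eqP xw; have := min q2; rewrite /detour xw wq2.
by move: Cw => /= /andP[_ ->] /(_ isT) /ltnW; rewrite leqNgt sz.
Qed.

Lemma next_consecutive (c : seq G) p1 a b p2 :
  uniq c -> c = p1 ++ a :: b :: p2 -> next c a = b.
Proof.
move=> uc Ec; rewrite -(next_rot (size p1) uc) Ec rot_size_cat /=.
by rewrite eqxx.
Qed.

(** An induced path, closed up by a vertex v adjacent to its two ends only. *)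
Lemma induced_cycle_closing v x y q : edge v x -> edge v y ->
    v != x -> v \notin q -> all (fun z => ~~ edge v z) q ->
    induced_path x (rcons q y) ->
  induced_cycle (v :: x :: rcons q y).
Proof.
move=> vx vy nvx nvq vq xp; have up := induced_path_uniq xp.
have uc : uniq (v :: x :: rcons q y).
  by rewrite cons_uniq up andbT inE mem_rcons inE !negb_or nvx nvq edge_neq.
have pathp := induced_path_path xp.
have closing : next (v :: x :: rcons q y) y = v.
  rewrite -(next_rotr 1 uc) -!rcons_cons rotr1_rcons /= eqxx //.
split; first by rewrite /ucycle /= vx rcons_path pathp last_rcons edge_sym vy.
have vnear b : b \in x :: rcons q y -> edge v b ->
    b = next (v :: x :: rcons q y) v \/ v = next (v :: x :: rcons q y) b.
  rewrite inE mem_rcons inE => /or3P[/eqP->|/eqP->|qb].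
  - by left; rewrite /= eqxx.
  - by right; rewrite closing.
  - by rewrite (negPf (allP vq _ qb)).
move=> a b; rewrite [a \in _]inE [b \in _]inE.
move=> /orP[/eqP->|pa] /orP[/eqP->|pb]; first by rewrite edge_irrefl.
- exact: vnear.
- by rewrite edge_sym => /(vnear _ pa)[]; [right|left].
move=> /(induced_path_edge xp pa pb)[p1 [p2 E]].
case: E => E; [left|right]; apply/esym/(@next_consecutive _ (v :: p1) _ _ p2) => //;
  by rewrite E.
Qed.

(** Otherwise a shortest path through C, which has an interior vertex, closes
up at v to an induced cycle of length at least 4. *)
Lemma chordal_no_detour C v x y q : chordal G -> edge v x -> edge v y ->
    x != y -> v \notin C -> y \notin C -> {in C, forall z, ~~ edge v z} ->
  detour C x y q -> edge x y.
Proof.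
move=> chG vx vy nxy nvC nyC vC dq; apply: contraT => nexy.
have ex : exists n, `[< exists2 q, detour C x y q & size q = n >].
  by exists (size q); apply/asboolP; exists q.
have [n /asboolP[p dp <-] nmin] := ex_minnP ex.
have pmin q' : detour C x y q' -> (size p <= size q')%N.
  by move=> dq'; apply: nmin; apply/asboolP; exists q'.
have ip := shortest_detour_induced nyC nxy dp pmin.
have /andP[_ /allP Cp] := dp.
have /chG : induced_cycle (v :: x :: rcons p y).
  apply: induced_cycle_closing => //; first exact: edge_neq.
    by apply/negP => /Cp; apply/negP.
  by apply/allP => z /Cp; apply: vC.
rewrite /= size_rcons; case: p dp {nmin pmin ip Cp} => // /andP[/= /andP[exy _] _].
by rewrite exy in nexy.
Qed.

(** * Chordal and perfect graphs *)

Definition neighbours W w := [set z in W | edge w z].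

(** Let C be the component of u among the vertices of W that are neither v nor
adjacent to v, and let S be the set of neighbours of v that have a neighbour in
C.  Any two vertices of S are joined by a path through C, so S is a clique by
chordality.  The neighbours in W of a vertex of C lie in the union of C and S,
which is smaller than W since it avoids v; it therefore suffices to find in C a
simplicial vertex of that union.  Asking for a simplicial vertex not adjacent to
a prescribed one makes the induction produce it inside C. *)
Lemma chordal_simplicial W u v : chordal G -> u \in W -> v \in W ->
    u != v -> ~~ edge v u ->
  exists w, [/\ w \in W, w != v, ~~ edge v w & clique (neighbours W w)].
Proof.
move=> chG; have [n] := ubnP #|W|; elim: n W u v => // n IHn W u v leWn Wu Wv nuv nvu.
pose D := [set z in W | (z != v) && ~~ edge v z].
pose r := [rel a b | [&& edge a b, a \in D & b \in D]].
pose C := [set z | connect r u z].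
pose S := [set s in W | edge v s && [exists z in C, edge s z]].
have rsym : connect_sym r.
  by apply: sym_connect_sym => a b /=; rewrite edge_sym [X in _ && X]andbC.
have Du : u \in D by rewrite inE Wu nuv.
have CD z : z \in C -> z \in D.
  rewrite inE => /connectP[p rp ->]; elim: p u Du rp {Wu nuv nvu C S} => //= a p IHp b Db.
  by move=> /andP[/and3P[_ _ Da] /IHp]; apply.
have Cu : u \in C by rewrite inE connect0.
have nvC : v \notin C by apply/negP => /CD; rewrite !inE eqxx andbF.
have CS z w : z \in C -> w \in W -> edge z w -> w \in C :|: S.
  move=> Cz Ww ezw; have := CD _ Cz; rewrite [z \in D]inE => /and3P[Wz nzv nvz].
  have nwv : w != v by apply: contraNneq nvz => <-; rewrite edge_sym.
  rewrite inE; have [vw|nvw] := boolP (edge v w).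
    apply/orP; right; rewrite inE Ww vw.
    by apply/existsP; exists z; rewrite Cz edge_sym.
  apply/orP; left; move: Cz; rewrite !inE => uz; apply: (connect_trans uz).
  by apply: connect1; rewrite /= ezw !inE Wz nzv nvz Ww nwv nvw.
have Sclique : clique S.
  apply/cliqueP => x y; rewrite !inE.
  move=> /and3P[Wx vx /existsP[a /andP[Ca xa]]] /and3P[Wy vy /existsP[b /andP[Cb yb]]] nxy.
  have notC z : edge v z -> z \notin C.
    by move=> vz; apply/negP => /CD; rewrite inE vz !andbF.
  have /connectP[p rp Eb] : connect r a b.
    by move: Ca Cb; rewrite !inE rsym => au ub; apply: connect_trans ub.
  apply: (@chordal_no_detour C v x y (a :: p)) => //; first exact: notC.
    by move=> z /CD; rewrite inE => /and3P[].
  rewrite /detour /= xa Ca rcons_path -Eb edge_sym yb andbT /=.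
  elim: p a Ca rp {Eb xa} => //= z p IHp a Ca /andP[az rp].
  have Cz : z \in C by move: Ca; rewrite !inE => ua; exact: connect_trans ua (@connect1 _ r _ _ az).
  by have /andP[-> ->] := IHp _ Cz rp; case/and3P: az => -> _ _; rewrite Cz.
have subW : C :|: S \subset W.
  by apply/fintype.subsetP => z; rewrite inE => /orP[/CD|]; rewrite inE => /andP[].
have ltW : (#|C :|: S| < n)%N.
  apply: (leq_trans _ (leWn : (#|W| <= n)%N)); apply: proper_card.
  rewrite properE subW; apply/fintype.subsetPn; exists v => //.
  by rewrite inE negb_or nvC inE edge_irrefl andbF.
have lift w : w \in C -> clique (neighbours (C :|: S) w) ->
    exists w, [/\ w \in W, w != v, ~~ edge v w & clique (neighbours W w)].
  move=> Cw cw; exists w; have := CD _ Cw; rewrite inE => /and3P[-> -> ->].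
  split=> //; apply: clique_sub cw; apply/fintype.subsetP => z; rewrite [z \in _]inE.
  by move=> /andP[Wz wz]; rewrite inE wz (CS w).
(* The vertex to avoid is taken in S if some vertex of S is not adjacent to all
   others: S is a clique, so the vertex found lies in C.  Otherwise vertices of
   S are adjacent to all others and can be neither a nor the vertex found. *)
have [/existsP[s /existsP[t /and4P[Ss CSt nst ntes]]]|noS] :=
    boolP [exists s, exists t, [&& s \in S, t \in C :|: S, t != s & ~~ edge s t]].
  have CSs : s \in C :|: S by rewrite inE Ss orbT.
  have [w [CSw nws nsw cw]] := IHn _ _ _ ltW CSt CSs nst ntes.
  apply: (lift w _ cw); move: CSw; rewrite inE => /orP[//|Sw].
  by move/cliqueP: Sclique nsw => /(_ _ _ Ss Sw) ->; rewrite // eq_sym.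
have Suniv s t : s \in S -> t \in C :|: S -> t != s -> edge s t.
  move=> Ss CSt nts; apply: contraNT noS => ns.
  by apply/existsP; exists s; apply/existsP; exists t; apply/and4P.
have [cCS|/cliqueP ncCS] := boolP (clique (C :|: S)).
  apply: (lift u Cu); apply: clique_sub cCS.
  by apply/fintype.subsetP => z; rewrite inE => /andP[].
have [a [b [CSa CSb nba neab]]] :
    exists a b, [/\ a \in C :|: S, b \in C :|: S, b != a & ~~ edge a b].
  apply: contra_notP ncCS => h a b CSa CSb nab; apply: contraT => neab.
  by case: h; exists a, b; rewrite eq_sym.
have [w [CSw nwa naw cw]] := IHn _ _ _ ltW CSb CSa nba neab.
apply: (lift w _ cw); move: CSw; rewrite inE => /orP[//|Sw].
by move: naw; rewrite edge_sym (Suniv w a) // eq_sym.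
Qed.

Lemma chordal_simplicial_nonempty W : chordal G -> W != finset.set0 ->
  exists2 w, w \in W & clique (neighbours W w).
Proof.
move=> chG /finset.set0Pn[v Wv]; have [cW|/cliqueP ncW] := boolP (clique W).
  exists v => //; apply: clique_sub cW.
  by apply/fintype.subsetP => z; rewrite inE => /andP[].
have [a [b [Wa Wb nba neab]]] :
    exists a b, [/\ a \in W, b \in W, b != a & ~~ edge a b].
  apply: contra_notP ncW => h a b Wa Wb nab; apply: contraT => neab.
  by case: h; exists a, b; rewrite eq_sym.
by have [w [Ww _ _ cw]] := chordal_simplicial chG Wb Wa nba neab; exists w.
Qed.

(** A simplicial vertex w and its neighbours form a clique, so the neighbours use
at most omega - 1 colours and one is left for w. *)
Lemma chordal_colorable k : chordal G -> clique_number G = k.+1 ->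
  colorable G k.+1.
Proof.
move=> chG omega.
suff [c cP] : exists c : G -> 'I_k.+1, {in [set: G] &, forall x y, edge x y -> c x != c y}.
  by apply/colorableP; exists c => x y; apply: cP.
have [n] := ubnP #|[set: G]|; elim: n [set: G] => // n IHn W leWn.
have [->|/(chordal_simplicial_nonempty chG)[w Ww cw]] := eqVneq W finset.set0.
  by exists (fun=> ord0) => x y; rewrite inE.
have [|c cP] := IHn (W :\ w); first by rewrite (cardsD1 w) Ww in leWn.
have /fintype.subsetPn[d _ dN] : ~~ ([set: 'I_k.+1] \subset c @: neighbours W w).
  apply/negP => /subset_leq_card; rewrite cardsT card_ord => le.
  have : clique (w |: neighbours W w).
    apply/cliqueP => x y /setU1P[->|Nx] /setU1P[->|Ny].
    - by rewrite eqxx.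
    - by move: Ny; rewrite inE => /andP[].
    - by move: Nx; rewrite inE edge_sym => /andP[].
    - by move/cliqueP: cw; apply.
  move=> /clique_number_ge; rewrite omega cardsU1 inE edge_irrefl andbF add1n.
  by rewrite leqNgt ltnS (leq_trans le (leq_imset_card _ _)).
have dP z : z \in W -> edge w z -> d != c z.
  move=> Wz wz; apply: contraNneq dN => ->.
  by apply: imset_f; rewrite inE Wz.
exists (fun z => if z == w then d else c z) => x y Wx Wy exy.
have [xw|xw] := eqVneq x w; have [yw|yw] := eqVneq y w.
- by rewrite xw yw edge_irrefl in exy.
- by apply: dP => //; rewrite -xw.
- by rewrite eq_sym; apply: dP => //; rewrite -yw edge_sym.
- by apply: cP; rewrite // !inE ?xw ?yw.
Qed.

End Cliques.
(** The subgraph induced on all vertices is a copy of G, so perfection applies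
to G itself after transporting colourings and cliques. *)
Lemma perfect_chromatic (G : sgraph) : perfect G ->
  chromatic_number G = clique_number G.
Proof.
move=> /(_ [set: G]) pG; apply/eqP; rewrite eqn_leq clique_number_le_chromatic andbT.
set H := Defs.induced [set: G] in pG.
have memT (x : G) : x \in [set: G] by rewrite inE.
apply: (@leq_trans (chromatic_number H)).
  apply: chromatic_number_le; have /colorableP[c cP] := colorable_chromatic H.
  by apply/colorableP; exists (fun x => c (exist _ x (memT x))) => x y exy; apply: cP.
rewrite pG; apply/bigmax_leqP => W /cliqueP Wc.
rewrite -(card_imset _ val_inj); apply/clique_number_ge/cliqueP.
move=> _ _ /imsetP[x Wx ->] /imsetP[y Wy ->] nxy.
by apply: Wc => //; apply: contraNneq nxy => ->.
Qed.

(** * The resurgence in terms of graph invariants *)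

Section GraphResurgence.
Variables (R : realType) (K : fieldType) (G : sgraph) (x0 y0 : G).
Hypothesis e0 : edge x0 y0.
Local Notation J := (cover_ideal G K).
Implicit Types (W : {set G}) (a : G -> nat).

Lemma clique_number_ge2 : (2 <= clique_number G)%N.
Proof.
have <- : #|[set x0; y0]| = 2%N by rewrite cards2 edge_neq.
apply/clique_number_ge/cliqueP => x y /set2P[]-> /set2P[]->; rewrite ?eqxx //.
by rewrite edge_sym.
Qed.

Lemma resurgence_le_chromatic :
  (resurgence R J <= (2 - 2 / (chromatic_number G)%:R)%:E)%E.
Proof.
have := leq_trans clique_number_ge2 (clique_number_le_chromatic G).
have := colorable_chromatic G; case: (chromatic_number G) => [|[|k]] // ck _.
exact: resurgence_le_colored.
Qed.

(** Two vertices of a clique outside V would span an uncovered edge. *)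
Lemma clique_cover_card W V : clique W -> vertex_cover V ->
  (#|W|.-1 <= #|W :&: V|)%N.
Proof.
move=> /cliqueP Wc /vertex_coverP Vc.
have : (#|W :\: V| <= 1)%N.
  apply/card_le1_eqP => x y; rewrite !inE => /andP[nVx Wx] /andP[nVy Wy].
  apply: contraTeq nVx ; rewrite eq_sym => nxy.
  have := Vc _ _ (Wc x y Wx Wy nxy).
  by rewrite (negPf nVy) orbF negbK.
by have := cardsID V W; lia.
Qed.

Lemma asymptotic_resurgence_ge_clique :
  ((2 - 2 / (clique_number G)%:R)%:E <= asymptotic_resurgence R J)%E.
Proof.
have w2 := clique_number_ge2.
have [W cW EW] : exists2 W : {set G}, clique W & clique_number G = #|W|.
  have some_clique : (0 < #|[pred W : {set G} | clique W]|)%N.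
    by apply/card_gt0P; exists finset.set0; apply/cliqueP => x y; rewrite inE.
  have [W cW EW] := eq_bigmax_cond (fun W : {set G} => #|W|) some_clique.
  by exists W.
rewrite EW in w2 *.
have -> : 2 - 2 / #|W|%:R = 2 * #|W|.-1%:R / #|W|%:R :> R.
  case: #|W| w2 => // n _; rewrite -natr1 /=.
  by field; rewrite gt_eqF //; have := ler0n R n; lra.
apply: (@asymptotic_resurgence_ge _ _ _ W _ _ (fun=> 1%N)) => //.
- by move=> V; apply: clique_cover_card.
- by rewrite sum1_card.
- by lia.
- by lia.
Qed.

Lemma resurgence_chromatic_eq_clique : chromatic_number G = clique_number G ->
  asymptotic_resurgence R J = resurgence R J /\
  resurgence R J = (2 - 2 / (clique_number G)%:R)%:E.
Proof.
move=> E; have := resurgence_le_chromatic; rewrite E => ub.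
have lb := asymptotic_resurgence_ge_clique.
have le := asymptotic_resurgence_le R J.
split; apply/eqP; rewrite eq_le; apply/andP; split=> //.
  exact: le_trans ub lb.
exact: le_trans lb le.
Qed.

Lemma cover_degree_gt0 s : (0 < s)%N -> (0 < cover_degree G K s)%N.
Proof.
move=> s0; have [[a /(_ _ _ e0) ac <-] _] := cover_degreeP G K s.
rewrite (bigD1 x0) //= (bigD1 y0) ?(eq_sym y0) ?edge_neq //=; lia.
Qed.

Lemma initial_degree_cover_ideal : initial_degree J = cover_degree G K 1.
Proof. by rewrite {1}cover_ideal_symbolic1. Qed.

Lemma cover_degree1_le W : vertex_cover W -> (cover_degree G K 1 <= #|W|)%N.
Proof.
move=> /vertex_coverP Wc; have [_ min] := cover_degreeP G K 1.
rewrite -sum1_card big_mkcond /=.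
have -> : (\sum_x (if x \in W then 1 else 0) = \sum_x (x \in W))%N.
  by apply: eq_bigr => x _; case: ifP.
by apply: min => x y /Wc; do 2!case: (_ \in W).
Qed.

(** The support of a 1-cover is a vertex cover, and its complement is an
independent set. *)
Lemma cover_degree1_ge :
  (#|G| <= cover_degree G K 1 + independence_number G)%N.
Proof.
have [[a ac <-] _] := cover_degreeP G K 1.
pose W := [set x | (0 < a x)%N].
rewrite -(cardC (mem W)); apply: leq_add.
  rewrite -sum1_card big_mkcond /=; apply: leq_sum => x _.
  by rewrite inE; case: (a x).
have -> : #|predC (mem W)| = #|~: W| by apply: eq_card => x; rewrite !inE.
apply: (@leq_bigmax_cond _ _ (fun W : {set G} => #|W|)).
apply/forall_inP => x; rewrite !inE => ax; apply/forall_inP => y; rewrite !inE => ay.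
by apply/negP => /ac; lia.
Qed.

Lemma alpha_ratioE :
  (initial_degree J)%:R / waldschmidt R J =
  2 * (cover_degree G K 1)%:R / (cover_degree G K 2)%:R :> R.
Proof.
rewrite initial_degree_cover_ideal waldschmidt_half.
by field; rewrite pnatr_eq0 -lt0n cover_degree_gt0.
Qed.

Lemma alpha_ratio_le :
  (((initial_degree J)%:R / waldschmidt R J)%:E <= asymptotic_resurgence R J)%E.
Proof.
rewrite alpha_ratioE; have [[a ac asum] _] := cover_degreeP G K 2.
apply: (@asymptotic_resurgence_ge _ _ _ [set: G] _ _ a) => //.
- by move=> W; rewrite finset.setTI; apply: cover_degree1_le.
- by rewrite -asum; apply: eq_bigl => x; rewrite inE.
- exact: cover_degree_gt0.
- exact: cover_degree_gt0.
Qed.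

Lemma alpha_ratio_ge : (0 < #|G|)%N ->
  2 - 2 / (#|G|%:R / (independence_number G)%:R) <=
  (initial_degree J)%:R / waldschmidt R J :> R.
Proof.
move=> n0; rewrite alpha_ratioE invf_div.
set c := cover_degree G K 1; set b := cover_degree G K 2.
have b0 : 0 < b%:R :> R by rewrite ltr0n cover_degree_gt0.
have nR : 0 < #|G|%:R :> R by rewrite ltr0n.
have bn : b%:R <= #|G|%:R :> R.
  rewrite ler_nat; have [_ min] := cover_degreeP G K 2.
  by rewrite -[leqRHS]sum1_card; apply: min.
have cn : #|G|%:R <= c%:R + (independence_number G)%:R :> R.
  by rewrite -natrD ler_nat cover_degree1_ge.
apply: (@le_trans _ _ (2 * c%:R / #|G|%:R)).
  rewrite ler_pdivlMr // mulrBl mulrA divfK ?gt_eqF //; lra.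
rewrite ler_wpM2l ?mulr_ge0 // lef_pV2 //.
Qed.

End GraphResurgence.

Theorem corollary4p6 (R : realType) (K : fieldType) (G : sgraph)
    (G_nonempty : (0 < #|G|)%N) (G_no_isolated : no_isolated G) :
  let J := cover_ideal G K in
  let rho : \bar R := resurgence R J in
  let rho_a : \bar R := asymptotic_resurgence R J in
  let alpha_ratio : R := (initial_degree J)%:R / waldschmidt R J in
  let omega : R := (clique_number G)%:R in
  let chi : R := (chromatic_number G)%:R in
  let chi_f : R := fractional_chromatic_number G R in
  [/\ (chromatic_number G = clique_number G ->
         rho_a = rho /\ rho = (2 - 2 / omega)%:E) /\
      (perfect G -> rho_a = rho /\ rho = (2 - 2 / omega)%:E),
      chordal G -> rho_a = rho /\ rho = (2 - 2 / omega)%:E &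
      chi_f = #|G|%:R / (independence_number G)%:R ->
        [/\ 2 - 2 / chi_f <= alpha_ratio,
            (alpha_ratio%:E <= rho_a)%E,
            (rho_a <= rho)%E &
            (rho <= (2 - 2 / chi)%:E)%E] /\
        (chi = chi_f ->
           [/\ alpha_ratio%:E = rho_a, rho_a = rho &
               rho = (2 - 2 / chi)%:E])].
Proof.
move=> J rho rho_a alpha_ratio omega chi chi_f.
have [x0 _] := card_gt0P G_nonempty; have [y0 e0] := G_no_isolated x0.
have sharp := @resurgence_chromatic_eq_clique R K G _ _ e0.
split; first by split=> [|/perfect_chromatic]; apply: sharp.
  move=> chG; apply: sharp; apply/eqP.
  rewrite eqn_leq clique_number_le_chromatic andbT.
  have := clique_number_ge2 e0; case E: (clique_number G) => [|k] // _.
  exact/chromatic_number_le/chordal_colorable.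
move=> chi_fE.
have le1 : 2 - 2 / chi_f <= alpha_ratio by rewrite chi_fE; apply: (alpha_ratio_ge _ _ e0).
have le2 : (alpha_ratio%:E <= rho_a)%E := alpha_ratio_le R K e0.
have le3 : (rho_a <= rho)%E := asymptotic_resurgence_le R J.
have le4 : (rho <= (2 - 2 / chi)%:E)%E := resurgence_le_chromatic R K e0.
split=> // E; have le0 : ((2 - 2 / chi)%:E <= alpha_ratio%:E)%E by rewrite E lee_fin.
have ge2 := le_trans (le_trans le3 le4) le0.
have ge3 := le_trans le4 (le_trans le0 le2).
have ge4 := le_trans le0 (le_trans le2 le3).
by split; apply/eqP; rewrite eq_le ?le2 ?le3 ?le4 ?ge2 ?ge3 ?ge4.
Qed.
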